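(* Let $F$ be a finite field of characteristic two, let $n>2$ be an integer, and let $C_{2^n}=\langle a\rangle$ be the cyclic group of order $2^n$. Let $\circledast_1\neq\circledast_2$ be two distinct involutions of the group algebra $FC_{2^n}$ arising from $C_{2^n}$, that is, two distinct elements of $\{\sigma_2,\sigma_3,\sigma_4\}$. Then the unitary subgroups $V_{\circledast_1}(FC_{2^n})$ and $V_{\circledast_2}(FC_{2^n})$ are not isomorphic as groups. In other words, $V_{\sigma_2}(FC_{2^n})$, $V_{\sigma_3}(FC_{2^n})$ and $V_{\sigma_4}(FC_{2^n})$ are pairwise non-isomorphic.
   Context: For a finite $2$-group $G$ and a finite field $F$ of characteristic two, $FG$ is the group algebra and $V(FG)$ is the group of normalized units, i.e. the units of $FG$ whose augmentation (sum of coefficients) equals $1$. An involution $\circledast$ of $FG$ arises from $G$ if it is the $F$-linear extension to $FG$ of an involution of $G$. The $\circledast$-unitary subgroup is $V_{\circledast}(FG)=\{u\in V(FG) : u^{\circledast}=u^{-1}\}$. For $G=C_{2^n}=\langle a\rangle$ with $n>2$, the automorphisms of $G$ of order exactly two are $\sigma_2: a\mapsto a^{-1}$, $\sigma_3: a\mapsto a^{2^{n-1}-1}$, $\sigma_4: a\mapsto a^{2^{n-1}+1}$; the same symbols denote their $F$-linear extensions to $FG$. *)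

(* Defs.v *)
From HB Require Import structures.
From mathcomp Require Import all_boot all_order all_fingroup all_algebra.

Set Implicit Arguments.
Unset Strict Implicit.
Unset Printing Implicit Defensive.

Import GRing.Theory.
Local Open Scope ring_scope.

(* MathComp's [group_ring] is a matrix encoding of the group algebra, not a type
   with a ring structure. Here F[gT] is the type of coefficient functions,
   under an alias, so that the ring product is convolution and not the
   pointwise product of {ffun gT -> F}. *)
Definition group_algebra (F : finFieldType) (gT : finGroupType) : Type :=
  {ffun gT -> F}.

HB.instance Definition _ (F : finFieldType) (gT : finGroupType) :=
  Finite.copy (group_algebra F gT) {ffun gT -> F}.
HB.instance Definition _ (F : finFieldType) (gT : finGroupType) :=
  GRing.Lmodule.copy (group_algebra F gT) {ffun gT -> F^o}.

Section GroupAlgebra.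

Variables (F : finFieldType) (gT : finGroupType).
Local Notation FG := (group_algebra F gT).

Definition coef (u : FG) (g : gT) : F := (u : {ffun gT -> F}) g.

Definition basis_elt (g : gT) : FG := [ffun h => (h == g)%:R].

Definition ga_mul (u v : FG) : FG :=
  [ffun g => \sum_h coef u h * coef v (h^-1 * g)%g].

Lemma coefP (u v : FG) : coef u =1 coef v -> u = v.
Proof. by move=> uv; apply/ffunP. Qed.

Lemma coefD u v g : coef (u + v) g = coef u g + coef v g.
Proof. by rewrite /coef ffunE. Qed.

Lemma coefZ c u g : coef (c *: u) g = c * coef u g.
Proof. by rewrite /coef ffunE. Qed.

Lemma coef_sum I (r : seq I) (P : pred I) (E : I -> FG) g :
  coef (\sum_(i <- r | P i) E i) g = \sum_(i <- r | P i) coef (E i) g.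
Proof.
elim/big_rec2: _ => [|i y x _ <-]; first by rewrite /coef ffunE.
by rewrite coefD.
Qed.

Lemma coef_basis g h : coef (basis_elt g) h = (h == g)%:R.
Proof. by rewrite /coef ffunE. Qed.

Lemma ga_mulE u v g :
  coef (ga_mul u v) g = \sum_h coef u h * coef v (h^-1 * g)%g.
Proof. by rewrite {1}/coef ffunE. Qed.

Fact ga_mulA : associative ga_mul.
Proof.
move=> u v w; apply: coefP => g; rewrite !ga_mulE.
under eq_bigr => h _ do rewrite ga_mulE mulr_sumr.
under [RHS]eq_bigr => h _ do rewrite ga_mulE mulr_suml.
rewrite exchange_big [RHS]exchange_big /=.
rewrite [LHS]exchange_big /=; apply: eq_bigr => h _.
rewrite (reindex_inj (mulgI h^-1%g)) /=; apply: eq_bigr => k _.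
by rewrite invMg invgK mulrA -mulgA mulKVg.
Qed.

Fact ga_mul1r : left_id (basis_elt 1%g) ga_mul.
Proof.
move=> u; apply: coefP => g; rewrite ga_mulE (bigD1 1%g) //= coef_basis eqxx.
rewrite mul1r invg1 mul1g big1 ?addr0 // => h /negbTE h1.
by rewrite coef_basis h1 mul0r.
Qed.

Fact ga_mulr1 : right_id (basis_elt 1%g) ga_mul.
Proof.
move=> u; apply: coefP => g; rewrite ga_mulE (bigD1 g) //= coef_basis mulVg.
rewrite eqxx mulr1 big1 ?addr0 // => h /negbTE hg.
by rewrite coef_basis -eq_mulVg1 hg mulr0.
Qed.

Fact ga_mulDl : left_distributive ga_mul +%R.
Proof.
move=> u v w; apply: coefP => g; rewrite coefD !ga_mulE -big_split /=.
by apply: eq_bigr => h _; rewrite coefD mulrDl.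
Qed.

Fact ga_mulDr : right_distributive ga_mul +%R.
Proof.
move=> u v w; apply: coefP => g; rewrite coefD !ga_mulE -big_split /=.
by apply: eq_bigr => h _; rewrite coefD mulrDr.
Qed.

Fact ga_1neq0 : basis_elt 1%g != 0.
Proof.
apply/eqP=> /(congr1 (coef^~ 1%g)); rewrite coef_basis eqxx /coef ffunE.
by apply/eqP; rewrite oner_eq0.
Qed.

HB.instance Definition _ := GRing.Zmodule_isNzRing.Build FG
  ga_mulA ga_mul1r ga_mulr1 ga_mulDl ga_mulDr ga_1neq0.

Lemma coefM (u v : FG) g :
  coef (u * v) g = \sum_h coef u h * coef v (h^-1 * g)%g.
Proof. exact: ga_mulE. Qed.

Fact ga_scaleAl (c : F) (u v : FG) : c *: (u * v) = (c *: u) * v.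
Proof.
apply: coefP => g; rewrite coefZ !coefM mulr_sumr.
by apply: eq_bigr => h _; rewrite coefZ mulrA.
Qed.

HB.instance Definition _ := GRing.Lmodule_isLalgebra.Build F FG ga_scaleAl.

Fact ga_scaleAr (c : F) (u v : FG) : c *: (u * v) = u * (c *: v).
Proof.
apply: coefP => g; rewrite coefZ !coefM mulr_sumr.
by apply: eq_bigr => h _; rewrite coefZ mulrCA.
Qed.

HB.instance Definition _ := GRing.Lalgebra_isAlgebra.Build F FG ga_scaleAr.

Definition ga_unit : pred FG :=
  [pred u | [exists v : FG, (v * u == 1) && (u * v == 1)]].
Definition ga_inv (u : FG) : FG :=
  odflt u [pick v | (v * u == 1) && (u * v == 1)].

Fact ga_mulVr : {in ga_unit, left_inverse 1 ga_inv *%R}.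
Proof.
move=> u /existsP[v uv]; rewrite /ga_inv.
by case: pickP => [w /andP[/eqP]//|/(_ v)]; rewrite uv.
Qed.

Fact ga_mulrV : {in ga_unit, right_inverse 1 ga_inv *%R}.
Proof.
move=> u /existsP[v uv]; rewrite /ga_inv.
by case: pickP => [w /andP[_ /eqP]//|/(_ v)]; rewrite uv.
Qed.

Fact ga_unitP (u v : FG) : v * u = 1 /\ u * v = 1 -> ga_unit u.
Proof. by case=> vu uv; apply/existsP; exists v; rewrite vu uv !eqxx. Qed.

Fact ga_inv_out : {in [predC ga_unit], ga_inv =1 id}.
Proof.
move=> u /= nu; rewrite /ga_inv; case: pickP => // v uv.
by case/existsP: nu; exists v.
Qed.

HB.instance Definition _ := GRing.NzRing_hasMulInverse.Build FG
  ga_mulVr ga_mulrV ga_unitP ga_inv_out.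

Definition augmentation (u : FG) : F := \sum_g coef u g.

(* V(F[gT]) *)
Definition normalized_units : {set {unit FG}} :=
  [set u | augmentation (val u) == 1].

(* An involution of a group is an anti-automorphism of order exactly two; on an
   abelian group this is an automorphism of order exactly two. *)
Definition group_involution (s : gT -> gT) : Prop :=
  [/\ {morph s : x y / (x * y)%g >-> (y * x)%g}, involutive s
    & exists x, s x != x].

Definition linear_extension (s : gT -> gT) (u : FG) : FG :=
  \sum_g coef u g *: basis_elt (s g).

Definition arises_from_group (star : FG -> FG) : Prop :=
  exists2 s, group_involution s & star =1 linear_extension s.

Definition unitary_subgroup (star : FG -> FG) : {set {unit FG}} :=
  [set u in normalized_units | star (val u) == (val u)^-1].

(* On a cyclic group <a>, the automorphism a |-> a ^+ k is x |-> x ^+ k. *)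
Definition sigma2 : FG -> FG := linear_extension (fun x => x^-1)%g.
Definition sigma3 (n : nat) : FG -> FG :=
  linear_extension (fun x => x ^+ (2 ^ n.-1 - 1))%g.
Definition sigma4 (n : nat) : FG -> FG :=
  linear_extension (fun x => x ^+ (2 ^ n.-1 + 1))%g.

Lemma augmentationM u v :
  augmentation (u * v) = augmentation u * augmentation v.
Proof.
rewrite /augmentation; under eq_bigr => g _ do rewrite coefM.
rewrite exchange_big mulr_suml; apply: eq_bigr => h _; rewrite -mulr_sumr.
by congr (_ * _); rewrite [RHS](reindex_inj (mulgI h^-1%g)).
Qed.

Lemma augmentation1 : augmentation 1 = 1.
Proof.
rewrite /augmentation (bigD1 1%g) //= coef_basis eqxx big1 ?addr0 // => g.
by rewrite coef_basis => /negbTE->.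
Qed.

Lemma coef_linear_extension s u g : involutive s ->
  coef (linear_extension s u) g = coef u (s g).
Proof.
move=> sK; rewrite coef_sum (bigD1 (s g)) //= coefZ coef_basis sK eqxx mulr1.
rewrite big1 ?addr0 // => h; rewrite coefZ coef_basis => hsg.
by case: eqP => [gsh|_]; [rewrite gsh sK eqxx in hsg | rewrite mulr0].
Qed.

Lemma arises_involutive star : arises_from_group star -> involutive star.
Proof.
case=> s [_ sK _] starE u; apply: coefP => g.
by rewrite !starE !coef_linear_extension // sK.
Qed.

Lemma arisesM star : arises_from_group star ->
  {morph star : u v / u * v >-> v * u}.
Proof.
case=> s [sM sK _] starE u v; apply: coefP => g.
have s1 : s 1%g = 1%g.
  by apply: (mulgI (s 1%g)); rewrite mulg1 -sM mulg1.
have sV x : s x^-1%g = (s x)^-1%g.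
  by apply: (mulgI (s x)); rewrite -sM mulVg mulgV s1.
rewrite !starE coef_linear_extension // !coefM.
pose f x := (g * (s x)^-1)%g.
have f_inj : injective f by move=> x y /mulgI/invg_inj/(can_inj sK).
rewrite [RHS](reindex_inj f_inj); apply: eq_bigr => h _.
rewrite !coef_linear_extension // mulrC /f; congr (coef v _ * coef u _).
  by rewrite sM sV sK.
by rewrite invMg invgK mulgKV sK.
Qed.

Lemma normalized_units_group_set : group_set normalized_units.
Proof.
apply/group_setP; split=> [|x y]; rewrite !inE /= ?augmentation1 //.
by move=> /eqP ax /eqP ay; rewrite augmentationM ax ay mulr1.
Qed.

Lemma unitary_subgroup_group_set star :
  arises_from_group star -> group_set (unitary_subgroup star).
Proof.
move=> starP; have starM := arisesM starP; have starK := arises_involutive starP.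
have star1 : star 1 = 1 by rewrite -[RHS]starK -[star 1]mul1r starM starK mul1r.
apply/group_setP; split=> [|x y].
  by rewrite !inE /= augmentation1 star1 invr1 !eqxx.
rewrite !inE => /andP[/eqP ax /eqP sx] /andP[/eqP ay /eqP sy].
by rewrite /= augmentationM ax ay mulr1 starM sx sy invrM ?eqxx ?(valP x, valP y).
Qed.

End GroupAlgebra.

(* Main.v *)
Require Import Defs.
From mathcomp Require Import all_boot all_order all_fingroup all_algebra.
From mathcomp Require Import cyclic abelian zify.

Set Implicit Arguments.
Unset Strict Implicit.
Unset Printing Implicit Defensive.

Import GRing.Theory.
Local Open Scope ring_scope.

(** The three unitary subgroups are told apart by their exponents, which are
    2 ^ n for sigma2, 2 ^ (n - 1) for sigma3 and 2 for sigma4; these numbers are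
    distinct because n > 2.

    Lower bounds come from group elements: g is unitary as soon as the involution
    inverts it, which applies to a for sigma2, to a ^ 2 for sigma3 and to
    c = a ^ (2 ^ (n - 1)) for sigma4.

    Upper bounds rest on [coef_mul_star]. Let s be an involutive
    anti-automorphism of G and star its linear extension. At an element g fixed
    by s, the terms of u * star u pair off under h |-> g (s h)^-1 and cancel in
    characteristic two, except those with h (s h) = g, so that the coefficient is
    the sum of the u_h ^ 2 over these h.
    - For sigma2 the bound 2 ^ n holds for every unit of augmentation 1, since
      in characteristic two u ^ (2 ^ k) is the sum of the
      u_h ^ (2 ^ k) h ^ (2 ^ k) ([coef_expr_pow2]).
    - For sigma3, h (s h) = h ^ (2 ^ (n - 1)). The coefficient of u * star u = 1
      at c is 0, so the sum of the u_h ^ 2 over the h with h ^ (2 ^ (n - 1)) = c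
      vanishes. Raising this sum to a power of two gives the coefficient of
      u ^ (2 ^ (n - 1)) at c; as all other h have h ^ (2 ^ (n - 1)) = 1, only
      the identity can remain in the support of u ^ (2 ^ (n - 1)), which
      therefore equals 1.
    - For sigma4, h (s h) = (h ^ 2) ^ m with m = 2 ^ (n - 2) + 1. Since m is odd,
      taking m-th powers is injective on G. For a square g, the square g ^ m is
      fixed by sigma4, and the coefficient of u ^ 2 at g is that of
      u * star u = 1 at g ^ m. As u ^ 2 is supported on squares, u ^ 2 = 1.

    It remains to see that sigma2, sigma3 and sigma4 are the only involutions
    arising from G: an involution of G is a power map x |-> x ^ k with
    k ^ 2 = 1 and k <> 1 modulo 2 ^ n, and [sqr1_mod_pow2] lists the
    possible k. *)

(** * Coefficients of powers and norms in characteristic two *)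

Section CharacteristicTwo.

Variable F : finFieldType.
Hypothesis charF : 2%N \in [pchar F].

(** The terms at i and f i agree, so they cancel in pairs unless f i = i. *)
Lemma sum_involution (I : finType) (f : I -> I) (E : I -> F) :
  involutive f -> (forall i, E (f i) = E i) ->
  \sum_i E i = \sum_(i | f i == i) E i.
Proof.
move=> fK Ef; rewrite (bigID (fun i => f i == i)) /= -[RHS]addr0; congr (_ + _).
(* The rank of i picks one element from each two-element orbit of f. *)
pose r (i : I) : nat := enum_rank i.
rewrite (bigID (fun i => (r i < r (f i))%N)) /=.
rewrite [X in _ + X](reindex_inj (can_inj fK)) /=.
under [X in _ + X]eq_bigr => i _ do rewrite Ef.
rewrite -[RHS](addrr_pchar2 charF
  (\sum_(i | (f i != i) && (r i < r (f i))%N) E i)).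
congr (_ + _); apply: eq_bigl => i; rewrite fK eq_sym; case: eqP => //= fi.
rewrite -leqNgt leq_eqVlt; case: eqP => //= /val_inj/enum_rank_inj fi'.
by case: fi.
Qed.

Lemma sum_expr_pow2 (I : Type) (s : seq I) (P : pred I) (E : I -> F) (k : nat) :
  (\sum_(i <- s | P i) E i) ^+ (2 ^ k) = \sum_(i <- s | P i) E i ^+ (2 ^ k).
Proof.
elim: k => [|k IHk]; first by rewrite expn0 expr1; apply: eq_bigr.
rewrite expnSr exprM IHk -(pFrobenius_autE charF) raddf_sum.
by apply: eq_bigr => i _; rewrite /= pFrobenius_autE exprM.
Qed.

Variable gT : finGroupType.
Local Notation FG := (group_algebra F gT).

(** The product of the coefficients of u at h and of star u at h^-1 g is
    u_h u_(f h) with f h = g (s h)^-1; the hypothesis s g = g makes f an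
    involution, whose fixed points are the h with h (s h) = g. *)
Lemma coef_mul_star (s : gT -> gT) (u : FG) (g : gT) :
    {morph s : x y / (x * y)%g >-> (y * x)%g} -> involutive s -> s g = g ->
  coef (u * linear_extension s u) g = \sum_(h | (h * s h)%g == g) coef u h ^+ 2.
Proof.
move=> sM sK sg; rewrite Defs.coefM.
have s1 : s 1%g = 1%g by apply: (mulgI (s 1%g)); rewrite mulg1 -sM mulg1.
have sV x : s x^-1%g = (s x)^-1%g.
  by apply: (mulgI (s x)); rewrite -sM mulVg mulgV s1.
pose f h := (g * (s h)^-1)%g.
have fK : involutive f.
  by move=> h; rewrite /f sM sV sK sg invMg invgK mulKVg.
under eq_bigr => h _ do
  rewrite coef_linear_extension // sM sV sg -/(f h).
rewrite (sum_involution fK) => [|h]; last by rewrite fK mulrC.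
apply: eq_big => h; last by move/eqP->; rewrite expr2.
by rewrite /f -(inj_eq (mulIg (s h))) mulgKV eq_sym.
Qed.

Hypothesis mulgC : forall x y : gT, commute x y.

(** The identity is an anti-automorphism of an abelian group, so this is a case
    of [coef_mul_star]. *)
Lemma coef_sqr (u : FG) (g : gT) :
  coef (u ^+ 2) g = \sum_(h | (h ^+ 2)%g == g) coef u h ^+ 2.
Proof.
have -> : u ^+ 2 = u * linear_extension id u.
  by congr (_ * _); apply: coefP => h; rewrite coef_linear_extension.
by rewrite coef_mul_star //; apply: mulgC.
Qed.

Lemma coef_expr_pow2 (u : FG) (g : gT) (k : nat) :
  coef (u ^+ (2 ^ k)) g =
    \sum_(h | (h ^+ (2 ^ k))%g == g) coef u h ^+ (2 ^ k).
Proof.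
elim: k g => [|k IHk] g.
  by rewrite expn0 expr1 (eq_bigl (eq_op^~ g)) ?big_pred1_eq.
rewrite expnSr exprM coef_sqr.
rewrite [RHS](partition_big (fun h => h ^+ (2 ^ k))%g
  (fun h => h ^+ 2 == g)%g) /=; last first.
  by move=> h; rewrite /= expgM.
apply: eq_bigr => h /eqP hg; rewrite IHk -[X in _ ^+ X = _]expn1 sum_expr_pow2.
apply: eq_big => [i|i _]; last by rewrite exprM.
by rewrite expgM; case: eqP => [->|]; rewrite ?andbF // hg eqxx.
Qed.

(** By [coef_expr_pow2] everything collapses onto the identity, where the
    coefficient is the power of the augmentation. *)
Lemma expr_group_exponent (u : FG) (k : nat) :
    (forall h : gT, h ^+ (2 ^ k) = 1)%g -> augmentation u = 1 ->
  u ^+ (2 ^ k) = 1.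
Proof.
move=> hk u1; apply: coefP => g; rewrite coef_expr_pow2 coef_basis.
case: eqP => [->|/eqP ng].
  rewrite -[RHS](expr1n _ (2 ^ k)) -u1 sum_expr_pow2.
  by apply: eq_bigl => h; rewrite hk eqxx.
by rewrite big_pred0 // => h; rewrite hk eq_sym (negbTE ng).
Qed.

End CharacteristicTwo.

(** * Group elements as units, and exponents of unitary subgroups *)

Section GroupUnits.

Variables (F : finFieldType) (gT : finGroupType).
Local Notation FG := (group_algebra F gT).

Lemma eq_linear_extension (s1 s2 : gT -> gT) :
  s1 =1 s2 -> @linear_extension F gT s1 =1 linear_extension s2.
Proof. by move=> s12 u; apply: eq_bigr => g _; rewrite s12. Qed.

Lemma eq_unitary_subgroup (star1 star2 : FG -> FG) :
  star1 =1 star2 -> unitary_subgroup star1 = unitary_subgroup star2.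
Proof. by move=> e; apply/setP => u; rewrite !inE e. Qed.

Lemma linear_extension_basis (s : gT -> gT) (g : gT) :
  linear_extension s (basis_elt F g) = basis_elt F (s g).
Proof.
rewrite /linear_extension (bigD1 g) //= coef_basis eqxx scale1r big1 ?addr0 //.
by move=> h /negbTE hg; rewrite coef_basis hg scale0r.
Qed.

Lemma basis_eltM (g h : gT) :
  basis_elt F (g * h) = basis_elt F g * basis_elt F h :> FG.
Proof.
apply: coefP => k; rewrite Defs.coefM (bigD1 g) //= !coef_basis eqxx mul1r.
rewrite big1 ?addr0 => [|i /negbTE ig]; last by rewrite coef_basis ig mul0r.
by rewrite -(inj_eq (mulgI g^-1)%g) mulKg.
Qed.

Lemma basis_elt_inj : injective (@basis_elt F gT).
Proof.
move=> g h /(congr1 (fun u : FG => coef u g)); rewrite !coef_basis eqxx.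
by case: eqP => // _ /eqP; rewrite oner_eq0.
Qed.

Lemma basis_elt_unit (g : gT) : (basis_elt F g : FG) \is a GRing.unit.
Proof.
by apply/unitrP; exists (basis_elt F g^-1%g); rewrite -!basis_eltM mulVg mulgV.
Qed.

Definition group_unit (g : gT) : {unit FG} :=
  FinRing.unit FG (basis_elt_unit g).

Lemma group_unitX (g : gT) (k : nat) :
  (group_unit g ^+ k = group_unit (g ^+ k))%g.
Proof.
elim: k => [|k IHk]; first exact: val_inj.
by rewrite !expgS IHk; apply: val_inj; rewrite /= basis_eltM.
Qed.

Lemma order_group_unit (g : gT) : #[group_unit g]%g = #[g]%g.
Proof.
have unit1 h : (group_unit h == 1%g) = (h == 1%g).
  by apply/eqP/eqP => [/(congr1 val)/basis_elt_inj|->]; [by []|exact: val_inj].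
apply/eqP; rewrite eqn_dvd !order_dvdn group_unitX unit1 expg_order eqxx.
by rewrite -unit1 -group_unitX expg_order eqxx.
Qed.

Lemma group_unit_unitary (s : gT -> gT) (g : gT) :
  s g = g^-1%g -> group_unit g \in unitary_subgroup (linear_extension s).
Proof.
move=> sg; rewrite !inE linear_extension_basis sg.
rewrite /augmentation (bigD1 g) //= coef_basis eqxx.
rewrite big1 ?addr0 ?eqxx /= => [|h /negbTE hg]; last by rewrite coef_basis hg.
rewrite -(inj_eq (mulrI (basis_elt_unit g))) divrr ?basis_elt_unit //.
by rewrite -basis_eltM mulgV.
Qed.

Lemma exponent_unitary_nisog (star1 star2 : FG -> FG) :
    arises_from_group star1 -> arises_from_group star2 ->
    exponent (unitary_subgroup star1) <> exponent (unitary_subgroup star2) ->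
  ~~ (unitary_subgroup star1 \isog unitary_subgroup star2)%g.
Proof.
move=> /unitary_subgroup_group_set g1 /unitary_subgroup_group_set g2 neq.
by apply/negP => /(@exponent_isog _ _ (Group g1) (Group g2)).
Qed.

Lemma unitary_subgroupP (star : FG -> FG) (u : {unit FG}) :
    u \in unitary_subgroup star ->
  augmentation (val u) = 1 /\ val u * star (val u) = 1.
Proof. by rewrite !inE => /andP[/eqP-> /eqP->]; rewrite divrr ?(valP u). Qed.

Lemma exponent_unitary_dvd (star : FG -> FG) (k : nat) :
    (forall u : FG, augmentation u = 1 -> u * star u = 1 -> u ^+ k = 1) ->
  (exponent (unitary_subgroup star) %| k)%N.
Proof.
move=> expk; apply/exponentP => u /unitary_subgroupP[u1 uu].
by apply: val_inj; rewrite FinRing.val_unitX expk.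
Qed.

End GroupUnits.

(** * Square roots of 1 modulo a power of two *)

Lemma pow2_mul8 (n : nat) : (2 < n)%N ->
  exists q, [/\ (0 < q)%N, (2 ^ n = 8 * q)%N & (2 ^ n.-1 = 4 * q)%N].
Proof.
case: n => [|[|[|p]]] // _; exists (2 ^ p)%N.
by rewrite expn_gt0 /= !expnS; split=> //; lia.
Qed.

(** Write k = 2 m + 1 and 2 ^ n = 4 q. Then k ^ 2 - 1 = 4 m (m + 1), so the power
    of two q divides m (m + 1), and hence divides the even one of the coprime
    factors m and m + 1. Only the parity of the quotient by q matters, because k is
    taken modulo 4 q; this leaves two cases for each factor. *)
Lemma sqr1_mod_pow2 (n k : nat) : (2 < n)%N -> k * k = 1 %[mod 2 ^ n] ->
  [\/ k = 1 %[mod 2 ^ n], k = 2 ^ n - 1 %[mod 2 ^ n],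
      k = 2 ^ n.-1 - 1 %[mod 2 ^ n] | k = 2 ^ n.-1 + 1 %[mod 2 ^ n]].
Proof.
case: n => [|[|[|p]]] // _ /=; set q := (2 ^ p.+1)%N.
have q2 : (2 ^ p.+2 = 2 * q)%N by rewrite expnS.
have q4 : (2 ^ p.+3 = 4 * q)%N by rewrite expnS q2; lia.
have coprime_q x : odd x -> coprime q x by rewrite coprime_pexpl // coprime2n.
have q_gt0 : (0 < q)%N by rewrite expn_gt0.
rewrite {}q4 {}q2; clearbody q; clear p => kk.
have k_odd : odd k.
  have := congr1 odd kk; rewrite !odd_mod ?oddM ?andbb //=.
have k_half := odd_double_half k; rewrite k_odd in k_half.
set m := k./2 in k_half.
have qm : (q %| m * m.+1)%N.
  have : (4 * q %| k * k - 1)%N by rewrite -eqn_mod_dvd; [apply/eqP | lia].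
  by rewrite (_ : k * k - 1 = 4 * (m * m.+1))%N; [rewrite dvdn_pmul2l | lia].
have [m_odd|m_even] := boolP (odd m).
  have : (q %| m.+1)%N.
    by rewrite -(@Gauss_dvdr _ m) // coprime_q.
  case/dvdnP=> j; rewrite -[j]odd_double_half; set i := j./2.
  case: (odd j) => /= mE.
    apply: Or43; have -> : (k = i * (4 * q) + (2 * q - 1))%N by lia.
    by rewrite modnMDl.
  apply: Or42; case: i mE => [|i] mE; first by lia.
  have -> : (k = i * (4 * q) + (4 * q - 1))%N by lia.
  by rewrite modnMDl.
have : (q %| m)%N.
  by rewrite -(@Gauss_dvdl _ _ m.+1) // coprime_q.
case/dvdnP=> j; rewrite -[j]odd_double_half; set i := j./2.
case: (odd j) => /= mE.
  apply: Or44; have -> : (k = i * (4 * q) + (2 * q + 1))%N by lia.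
  by rewrite modnMDl.
apply: Or41; have -> : (k = i * (4 * q) + 1)%N by lia.
by rewrite modnMDl.
Qed.

(** * The cyclic group of order 2 ^ n *)

Section CyclicTwoGroup.

Variables (F : finFieldType) (gT : finGroupType) (a : gT) (n : nat).
Hypothesis n_gt2 : (2 < n)%N.
Hypotheses (gen_a : [set: gT] = <[a]>%g) (ord_a : #[a]%g = (2 ^ n)%N).
Local Notation FG := (group_algebra F gT).

Lemma expg_a_surj (x : gT) : exists i, x = (a ^+ i)%g.
Proof. by apply/cycleP; rewrite -gen_a inE. Qed.

Lemma mulgC_cyclic (x y : gT) : commute x y.
Proof.
have [i ->] := expg_a_surj x; have [j ->] := expg_a_surj y.
exact/commuteX2/commute_refl.
Qed.

Lemma expg_mod_pow2n (x : gT) (i j : nat) :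
  i = j %[mod 2 ^ n] -> (x ^+ i = x ^+ j)%g.
Proof.
have [k ->] := expg_a_surj x => ij; rewrite -!expgM; apply/eqP.
by rewrite eq_expg_mod_order ord_a -modnMmr ij modnMmr.
Qed.

Lemma power_map_involution (k : nat) :
    k * k = 1 %[mod 2 ^ n] -> k <> 1 %[mod 2 ^ n] ->
  group_involution (fun x : gT => x ^+ k)%g.
Proof.
move=> kk k1; split=> [x y|x|].
- rewrite expgMn; last exact: mulgC_cyclic.
  exact/commuteX2/mulgC_cyclic.
- by rewrite -expgM (expg_mod_pow2n _ kk).
by exists a; rewrite -{2}[a]expg1 eq_expg_mod_order ord_a; apply/eqP.
Qed.

Lemma involution_power_map (s : gT -> gT) :
    group_involution s -> exists k : nat,
  [/\ k * k = 1 %[mod 2 ^ n], k <> 1 %[mod 2 ^ n] & s =1 fun x => (x ^+ k)%g].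
Proof.
case=> sM sK [x sx]; have [k sa] := expg_a_surj (s a).
have sE y : s y = (y ^+ k)%g.
  have [i ->] := expg_a_surj y; rewrite expgAC -sa.
  elim: i => [|i IHi]; last by rewrite expgS expgSr sM IHi.
  by apply: (mulgI (s 1)%g); rewrite -sM !mulg1.
exists k; split=> // [|k1].
  by apply/eqP; rewrite -ord_a -eq_expg_mod_order expg1 expgM -!sE sK.
by rewrite sE (expg_mod_pow2n _ k1) expg1 eqxx in sx.
Qed.

(** This form lets inversion be treated together with the other power maps. *)
Lemma sigma2E : @sigma2 F gT =1 linear_extension (fun x => x ^+ (2 ^ n - 1))%g.
Proof.
apply: eq_linear_extension => x; apply/eqP; rewrite eq_invg_mul -expgS.
rewrite subn1 prednK ?expn_gt0 //.
by rewrite (@expg_mod_pow2n _ _ 0) ?expg0 // modnn mod0n.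
Qed.

Definition is_sigma_exponent (k : nat) :=
  k \in [:: 2 ^ n - 1; 2 ^ n.-1 - 1; 2 ^ n.-1 + 1]%N.

Lemma sigma_involution (k : nat) :
  is_sigma_exponent k -> group_involution (fun x : gT => x ^+ k)%g.
Proof.
rewrite /is_sigma_exponent !inE => k_sigma.
have [[|r] [r_gt0 Nr Mr]] := pow2_mul8 n_gt2; first by [].
(* With 2 ^ n = 8 (r + 1) the exponents become subtraction-free. *)
have kE : [\/ k = (8 * r + 7)%N, k = (4 * r + 3)%N | k = (4 * r + 5)%N].
  case/or3P: k_sigma => /eqP->; [apply: Or31 | apply: Or32 | apply: Or33]; lia.
apply: power_map_involution; rewrite Nr mulnS; last first.
  by rewrite !modn_small; case: kE => ?; lia.
apply/eqP; rewrite eqn_mod_dvd; last by case: kE => ->; lia.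
apply/dvdnP; case: kE => ->.
- by exists (8 * r + 6)%N; lia.
- by exists (2 * r + 1)%N; lia.
by exists (2 * r + 3)%N; lia.
Qed.

Lemma arises_sigmaP (star : FG -> FG) :
  arises_from_group star <->
  [\/ star =1 @sigma2 F gT, star =1 @sigma3 F gT n | star =1 @sigma4 F gT n].
Proof.
split=> [[s /involution_power_map[k [kk k1 sE]] starE]|].
  have ext j : k = j %[mod 2 ^ n] ->
      star =1 linear_extension (fun x => x ^+ j)%g.
    move=> kj u; rewrite starE; apply: eq_linear_extension => x.
    by rewrite sE (expg_mod_pow2n _ kj).
  case: (sqr1_mod_pow2 n_gt2 kk) => [//|/ext kE|/ext kE|/ext kE].
  - by apply: Or31 => u; rewrite kE sigma2E.
  - exact: Or32.
  exact: Or33.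
have arises k : is_sigma_exponent k ->
    star =1 linear_extension (fun x => x ^+ k)%g -> arises_from_group star.
  by move=> /sigma_involution ? ?; exists (fun x => x ^+ k)%g.
case=> starE; [apply: (arises (2 ^ n - 1)%N) | apply: (arises (2 ^ n.-1 - 1)%N)
  | apply: (arises (2 ^ n.-1 + 1)%N)];
  rewrite /is_sigma_exponent ?inE ?eqxx ?orbT //.
by move=> u; rewrite starE sigma2E.
Qed.

(** * The three exponents *)

Hypothesis charF : 2%N \in [pchar F].

Lemma exponent_sigma2 : exponent (unitary_subgroup (@sigma2 F gT)) = (2 ^ n)%N.
Proof.
apply/eqP; rewrite eqn_dvd; apply/andP; split.
  apply: exponent_unitary_dvd => u u1 _.
  apply: (expr_group_exponent charF mulgC_cyclic) => // h.
  by rewrite (@expg_mod_pow2n _ _ 0) // modnn mod0n.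
rewrite -ord_a -(order_group_unit F); apply: dvdn_exponent.
exact: group_unit_unitary.
Qed.

(** The h with h ^ (2 ^ (n - 1)) = c contribute nothing to u ^ (2 ^ (n - 1)),
    because the norm relation read at c says that their squared coefficients
    sum to 0. *)
Lemma sigma3_unitary_expr (u : FG) :
  augmentation u = 1 -> u * sigma3 n u = 1 -> u ^+ (2 ^ n.-1) = 1.
Proof.
move=> u1 uu.
have n1 : (n = n.-1.+1)%N by lia.
have n2 : (n.-1 = n.-2.+1)%N by lia.
have N2 : (2 ^ n = 2 ^ n.-1 * 2)%N by rewrite {1}n1 expnSr.
have N1_gt1 : (1 < 2 ^ n.-1)%N.
  by rewrite n2 expnS; have := expn_gt0 2 n.-2; lia.
pose c := (a ^+ (2 ^ n.-1))%g.
have cc : (c ^+ 2 = 1)%g by rewrite -expgM -N2 -ord_a expg_order.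
have c_neq1 : c != 1%g.
  by rewrite -order_dvdn ord_a dvdn_Pexp2l //; lia.
have pow1c (h : gT) : (h ^+ (2 ^ n.-1) == 1)%g || (h ^+ (2 ^ n.-1) == c)%g.
  have [i ->] := expg_a_surj h; rewrite expgAC -/c.
  rewrite -(odd_double_half i) expgD -mul2n expgM cc expg1n mulg1.
  by case: (odd i); rewrite ?expg1 ?expg0 eqxx ?orbT.
have [sM sK _] : group_involution (fun x : gT => x ^+ (2 ^ n.-1 - 1))%g.
  by apply: sigma_involution; rewrite /is_sigma_exponent !inE eqxx orbT.
(* The exponent is odd, and c has order 2. *)
have sc : (c ^+ (2 ^ n.-1 - 1) = c)%g.
  apply: (mulIg c); rewrite -expgSr subn1 prednK; last by rewrite ltnW.
  by rewrite -expg2 cc n2 expnS expgM cc expg1n.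
(* These h are the odd powers of a. *)
have odd0 : \sum_(h | (h ^+ (2 ^ n.-1) == c)%g) coef u h ^+ 2 = 0.
  transitivity (coef (u * sigma3 n u) c); last first.
    by rewrite uu coef_basis (negbTE c_neq1).
  rewrite coef_mul_star //; apply: eq_bigl => h.
  by rewrite -expgS subn1 prednK // ltnW.
have {odd0} wc : coef (u ^+ (2 ^ n.-1)) c = 0.
  rewrite (coef_expr_pow2 charF mulgC_cyclic).
  rewrite (eq_bigr (fun h => (coef u h ^+ 2) ^+ (2 ^ n.-2))) => [|h _].
    by rewrite -sum_expr_pow2 // odd0 expr0n expn_eq0.
  by rewrite -exprM -expnS -n2.
have w1 : augmentation (u ^+ (2 ^ n.-1)) = 1.
  elim: (2 ^ n.-1)%N => [|k IHk]; first by rewrite expr0 augmentation1.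
  by rewrite exprS augmentationM u1 mul1r.
have w0 g : g != 1%g -> coef (u ^+ (2 ^ n.-1)) g = 0.
  move=> g1; have [->//|gc] := eqVneq g c.
  rewrite (coef_expr_pow2 charF mulgC_cyclic) big_pred0 // => h.
  apply: contraTF (pow1c h) => /eqP->.
  by rewrite (negbTE g1) (negbTE gc).
apply: coefP => g; rewrite coef_basis; have [->|/w0//] := eqVneq g 1%g.
by rewrite -w1 /augmentation [RHS](bigD1 1%g) //= [X in _ + X]big1 ?addr0.
Qed.

Lemma exponent_sigma3 :
  exponent (unitary_subgroup (@sigma3 F gT n)) = (2 ^ n.-1)%N.
Proof.
have N2 : (2 ^ n = 2 ^ n.-1 * 2)%N by rewrite -expnSr prednK //; lia.
apply/eqP; rewrite eqn_dvd; apply/andP; split.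
  exact/exponent_unitary_dvd/sigma3_unitary_expr.
rewrite (_ : (2 ^ n.-1)%N = #[a ^+ 2]%g); last first.
  rewrite orderXdiv ord_a; last by rewrite N2 dvdn_mull.
  by rewrite N2 mulnK.
rewrite -(order_group_unit F); apply: dvdn_exponent.
apply: group_unit_unitary; apply/eqP; rewrite eq_sym eq_invg_mul -expgS.
rewrite subn1 prednK; last by rewrite expn_gt0.
by rewrite -expgM mulnC -N2 -ord_a expg_order.
Qed.

(** Since h (s h) = (h ^ 2) ^ m with m = 2 ^ (n - 2) + 1 odd, the norm relation
    at the m-th powers of squares gives the coefficients of u ^ 2. *)
Lemma sigma4_unitary_sqr (u : FG) : u * sigma4 n u = 1 -> u ^+ 2 = 1.
Proof.
move=> uu; have [q [q_gt0 Nq Mq]] := pow2_mul8 n_gt2.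
pose m := (2 * q + 1)%N.
have m_inj : injective (fun x : gT => x ^+ m)%g.
  have coprime_m : coprime #|[set: gT]| m.
    by rewrite gen_a -orderE ord_a coprimeXl // coprime2n /m; lia.
  by move=> x y xy; rewrite -(expgK coprime_m (in_setT x)) /= xy expgK ?inE.
have [sM sK _] : group_involution (fun x : gT => x ^+ (2 ^ n.-1 + 1))%g.
  by apply: sigma_involution; rewrite /is_sigma_exponent !inE eqxx !orbT.
apply: coefP => g; rewrite (coef_sqr charF mulgC_cyclic).
(* sigma4 fixes the squares, so the norm relation can be read at g ^ m. *)
have [/existsP[k /eqP kg]|/existsPn nosqrt] := boolP [exists k, k ^+ 2 == g]%g.
  transitivity (coef (u * sigma4 n u) (g ^+ m)%g).
    rewrite coef_mul_star //; last first.
      rewrite -kg -!expgM; apply: expg_mod_pow2n.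
      rewrite Nq Mq /m.
      rewrite (_ : _ * _ = (2 * q + 1) * (8 * q) + 2 * (2 * q + 1))%N.
        by rewrite modnMDl.
      by lia.
    apply: eq_bigl => h; rewrite -expgS -(inj_eq m_inj) -expgM Mq /m.
    by congr (_ ^+ _ == _)%g; lia.
  by rewrite uu !coef_basis -[in RHS](inj_eq m_inj) /= expg1n.
rewrite big_pred0 => [|h]; last exact/negbTE/nosqrt.
rewrite coef_basis; case: eqP => // g1.
by have := nosqrt 1%g; rewrite g1 expg1n eqxx.
Qed.

Lemma exponent_sigma4 : exponent (unitary_subgroup (@sigma4 F gT n)) = 2%N.
Proof.
have [q [q_gt0 Nq Mq]] := pow2_mul8 n_gt2.
apply/eqP; rewrite eqn_dvd; apply/andP; split.
  by apply: exponent_unitary_dvd => u _; apply: sigma4_unitary_sqr.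
rewrite (_ : 2%N = #[a ^+ (2 ^ n.-1)]%g); last first.
  rewrite orderXdiv ord_a; last by rewrite dvdn_exp2l // leq_pred.
  by rewrite Nq Mq (_ : 8 * q = 2 * (4 * q))%N ?mulnK; lia.
rewrite -(order_group_unit F); apply: dvdn_exponent.
apply: group_unit_unitary; apply/eqP; rewrite eq_sym eq_invg_mul -expgS.
rewrite -expgM -order_dvdn ord_a Nq Mq.
by apply/dvdnP; exists (2 * q + 1)%N; lia.
Qed.

End CyclicTwoGroup.

Theorem theorem1 (F : finFieldType) (gT : finGroupType) (a : gT) (n : nat)
    (charF : 2%N \in [pchar F]) (n_gt2 : (2 < n)%N)
    (gen_a : [set: gT] = <[a]>%g) (ord_a : #[a]%g = (2 ^ n)%N) :
  (forall star1 star2 : group_algebra F gT -> group_algebra F gT,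
     arises_from_group star1 -> arises_from_group star2 ->
     ~ (star1 =1 star2) ->
     ~~ (unitary_subgroup star1 \isog unitary_subgroup star2)%g)
  /\ [/\ ~~ (unitary_subgroup (@sigma2 F gT) \isog
               unitary_subgroup (@sigma3 F gT n))%g,
         ~~ (unitary_subgroup (@sigma2 F gT) \isog
               unitary_subgroup (@sigma4 F gT n))%g
       & ~~ (unitary_subgroup (@sigma3 F gT n) \isog
               unitary_subgroup (@sigma4 F gT n))%g].
Proof.
have e2 := exponent_sigma2 gen_a ord_a charF.
have e3 := exponent_sigma3 n_gt2 gen_a ord_a charF.
have e4 := exponent_sigma4 n_gt2 gen_a ord_a charF.
have [q [q_gt0 Nq Mq]] := pow2_mul8 n_gt2.
have arisesP (star : group_algebra F gT -> group_algebra F gT) :=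
  arises_sigmaP n_gt2 gen_a ord_a star.
have arises2 := (arisesP _).2 (Or31 _ _ (frefl (@sigma2 F gT))).
have arises3 := (arisesP _).2 (Or32 _ _ (frefl (@sigma3 F gT n))).
have arises4 := (arisesP _).2 (Or33 _ _ (frefl (@sigma4 F gT n))).
split; last first.
  by split; apply: exponent_unitary_nisog => //; rewrite ?e2 ?e3 ?e4; lia.
move=> star1 star2 A1 A2 neq; apply: exponent_unitary_nisog => //.
case/arisesP: A1 => E1; case/arisesP: A2 => E2;
  rewrite (eq_unitary_subgroup E1) (eq_unitary_subgroup E2) ?e2 ?e3 ?e4;
  by [case: neq => u; rewrite E1 E2 | lia].
Qed.
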